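(* Let $A=T(V)/(R)$ be an $N$-homogeneous algebra and $M$ be an $A$-bimodule. For any Koszul $p$-cochain $f$ with coefficients in $M$, we have \begin{enumerate} \item $[e_A,f]_{\underset{K}{\smile}}=-\,b_K(f)$ if $p$ is even, \item $[e_A,f]_{\underset{K}{\smile}}=(1-N)\,b_K(f)$ if $p$ is odd. \end{enumerate}
   Context: $k$ is a field, $N\ge 2$ an integer, $V$ a $k$-vector space, $R\subseteq V^{\otimes N}$ a subspace, and $A=T(V)/(R)$, graded by weight ($V$ in weight 1). $\otimes$ means $\otimes_k$; $A$-bimodules are left modules over $A^e=A\otimes A^{op}$. For $p\ge 0$, $W_p=\bigcap_{i+N+j=p}V^{\otimes i}\otimes R\otimes V^{\otimes j}\subseteq V^{\otimes p}$ (so $W_p=V^{\otimes p}$ for $p<N$, $W_N=R$). Define $\nu(2p')=Np'$ and $\nu(2p'+1)=Np'+1$. An arbitrary element of $W_p$ is written as a product $x_1\ldots x_p$ with $x_i\in V$ (a linear combination of such tensors is understood); when $q+r+s=p$, viewing it in $V^{\otimes q}\otimes W_r\otimes V^{\otimes s}$, the factor $x_{q+1}\ldots x_{q+r}$ is thought of as an element of $W_r$. All formulas are extended linearly. Koszul $p$-cochains with coefficients in a bimodule $M$ are the elements of $Hom(W_{\nu(p)},M)$ ($k$-linear maps), with differential: if $p=2p'$, $$b_K(f)(x_1\ldots x_{Np'+1})=f(x_1\ldots x_{Np'})x_{Np'+1}-x_1f(x_2\ldots x_{Np'+1});$$ if $p=2p'+1$, $$b_K(f)(x_1\ldots x_{Np'+N})=\sum_{0\le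 i\le N-1}x_1\ldots x_i f(x_{i+1}\ldots x_{i+Np'+1})x_{i+Np'+2}\ldots x_{Np'+N}.$$ Koszul cup product: for $f:W_{\nu(p)}\to P$, $g:W_{\nu(q)}\to Q$, the cochain $f\underset{K}{\smile} g:W_{\nu(p+q)}\to P\otimes_A Q$ is defined as follows. If $p,q$ are not both odd (so $\nu(p+q)=\nu(p)+\nu(q)$), $$(f\underset{K}{\smile} g)(x_1\ldots x_{\nu(p+q)})=f(x_1\ldots x_{\nu(p)})\otimes_A g(x_{\nu(p)+1}\ldots x_{\nu(p)+\nu(q)}).$$ If $p,q$ are both odd (so $\nu(p+q)=\nu(p)+\nu(q)+N-2$), $$(f\underset{K}{\smile} g)(x_1\ldots x_{\nu(p+q)})=-\sum_{0\le i+j\le N-2}x_1\ldots x_i f(x_{i+1}\ldots x_{i+\nu(p)})x_{i+\nu(p)+1}\ldots x_{\nu(p)+N-j-2}\otimes_A g(x_{\nu(p)+N-j-1}\ldots x_{\nu(p)+\nu(q)+N-j-2})x_{\nu(p)+\nu(q)+N-j-1}\ldots x_{\nu(p)+\nu(q)+N-2},$$ the sum being over integers $i,j\ge 0$. Koszul cup bracket: if at least one of $P,Q$ equals $A$ (using $A\otimes_A M\cong M\cong M\otimes_A A$), $[f,g]_{\underset{K}{\smile}}=f\underset{K}{\smile} g-(-1)^{pq}g\underset{K}{\smile} f$. The fundamental 1-cocycle $e_A:V\to A$ is the Koszul 1-cochain with coefficients in $A$ given by the identity of $V$ followed by the inclusion $V\subset A$. *)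

(* Defs.v *)
From HB Require Import structures.
From mathcomp Require Import all_boot all_order all_algebra.
From mathcomp Require Import boolp.
From mathcomp Require Import finmap monalg.

Set Implicit Arguments.
Unset Strict Implicit.
Unset Printing Implicit Defensive.

Import GRing.Theory.
Local Open Scope ring_scope.
Local Open Scope quotient_scope.

(******************************************************************************)
(* Conventions                                                                *)
(* - Everything lives inside the tensor algebra T(V) = talg V, in which       *)
(*   V^{\otimes n} is the subspace tpow V n spanned by the products of n      *)
(*   vectors. Since k is a field, for subspaces X of V^{\otimes m} and Y of   *)
(*   V^{\otimes n}, X \otimes Y is identified with its image in               *)
(*   V^{\otimes m+n}, the span of the products xy with x in X and y in Y.     *)
(* - submodClosed U is the type of subspaces of U, and subsp S is the         *)
(*   subspace S as a vector space of its own; thus the space of relations R   *)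
(*   has type submodClosed (subsp (tpow V N)).                                *)
(* - MathComp algebras satisfy 1 <> 0, so quotients of algebras are formed    *)
(*   for proper ideals only. This is why halg hN R, the N-homogeneous algebra *)
(*   T(V)/(R), depends on hN : 1 < N.                                         *)
(* - The ground field acts centrally on bimodules, so that bimodType A is the *)
(*   type of left modules over A^e = A \otimes A^op.                          *)
(* - kdiff is b_K, kcup the Koszul cup product, kbracket the Koszul cup       *)
(*   bracket for a first argument with coefficients in A, and fund_cocycle    *)
(*   is e_A.                                                                  *)
(******************************************************************************)

Section Subspaces.
Variables (k : fieldType) (U : lmodType k).

Record subsp (S : submodClosed U) : Type :=
  Subsp { subsp_val : U; _ : subsp_val \in S }.

HB.instance Definition _ S := [isSub for @subsp_val S].
HB.instance Definition _ S := [Choice of subsp S by <:].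
End Subspaces.

Section SubspLmodule.
Variables (k : fieldType) (U : lmodType k) (S : submodClosed U).

HB.instance Definition _ :=
  GRing.SubChoice_isSubLmodule.Build k U (S : {pred U}) (subsp S)
    (GRing.submodClosedP S).
End SubspLmodule.

Section Span.
Variables (k : fieldType) (U : lmodType k) (G : U -> Prop).

Inductive in_lspan : U -> Prop :=
| span_gen u : G u -> in_lspan u
| span_zero : in_lspan 0
| span_lin c u v : in_lspan u -> in_lspan v -> in_lspan (c *: u + v).

Definition lspan : {pred U} := fun u => `[< in_lspan u >].

Lemma spanP u : reflect (in_lspan u) (u \in lspan).
Proof. exact: asboolP. Qed.

Lemma span_closed : submod_closed lspan.
Proof.
split=> [|c u v /spanP uS /spanP vS]; apply/spanP; first exact: span_zero.
exact: span_lin.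
Qed.

HB.instance Definition _ := GRing.isSubmodClosed.Build k U lspan span_closed.

Definition quotmod : Type := {ideal_quot lspan}.

HB.instance Definition _ := GRing.Zmodule.on quotmod.

Definition qpi (u : U) : quotmod := \pi_({ideal_quot lspan}) u.

Lemma qpiP u v : reflect (qpi u = qpi v) (u - v \in lspan).
Proof. by rewrite Quotient.idealrBE; exact: eqP. Qed.

Lemma qpi_surj (x : quotmod) : qpi (repr x) = x.
Proof. exact: reprK. Qed.

Lemma qpiD u v : qpi (u + v) = qpi u + qpi v.
Proof. exact: raddfD. Qed.

Definition qscale c (x : quotmod) : quotmod := qpi (c *: repr x).

Lemma qpiZ c u : qpi (c *: u) = qscale c (qpi u).
Proof.
apply/qpiP; rewrite -scalerBr rpredZ //; apply/qpiP.
by rewrite qpi_surj.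
Qed.

Lemma qscaleA a b x : qscale a (qscale b x) = qscale (a * b) x.
Proof. by rewrite -(qpi_surj x) -!qpiZ scalerA. Qed.

Lemma qscale1 : left_id 1 qscale.
Proof. by move=> x; rewrite -(qpi_surj x) -!qpiZ scale1r. Qed.

Lemma qscaleDr : right_distributive qscale +%R.
Proof.
move=> a x y; rewrite -(qpi_surj x) -(qpi_surj y).
by rewrite -qpiD -!qpiZ -qpiD scalerDr.
Qed.

Lemma qscaleDl x : {morph qscale^~ x : a b / a + b}.
Proof. by move=> a b; rewrite -(qpi_surj x) -!qpiZ -qpiD scalerDl. Qed.

HB.instance Definition _ := GRing.Zmodule_isLmodule.Build k quotmod
  qscaleA qscale1 qscaleDr qscaleDl.

Lemma qpi_linear : linear qpi.
Proof. by move=> c u v; rewrite qpiD qpiZ. Qed.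

HB.instance Definition _ := GRing.isLinear.Build k U quotmod *:%R qpi qpi_linear.

Section Lift.
Variables (M : lmodType k) (h : {linear U -> M}).
Hypothesis hG : forall u, G u -> h u = 0.

Definition qlift (_ : forall u, G u -> h u = 0) (x : quotmod) : M := h (repr x).

Lemma span_vanish u : u \in lspan -> h u = 0.
Proof.
move/spanP; elim=> [v /hG//||c v w _ hv _ hw]; first exact: linear0.
by rewrite linearP hv hw scaler0 addr0.
Qed.

Lemma qliftE u : qlift hG (qpi u) = h u.
Proof.
rewrite /qlift; apply/eqP; rewrite -subr_eq0 -linearB /=; apply/eqP.
by apply: span_vanish; apply/qpiP; rewrite qpi_surj.
Qed.

Lemma qlift_linear : linear (qlift hG).
Proof.
move=> c x y; rewrite -(qpi_surj x) -(qpi_surj y) -linearP !qliftE.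
exact: linearP.
Qed.

HB.instance Definition _ :=
  GRing.isLinear.Build k quotmod M *:%R (qlift hG) qlift_linear.
End Lift.
End Span.

Section QuotientAlgebra.
Variables (k : fieldType) (B : algType k) (G : B -> Prop).

Definition ideal : {pred B} :=
  lspan (fun x => exists a g b, G g /\ x = a * g * b).

HB.instance Definition _ := GRing.SubmodClosed.on ideal.

Lemma idealM a b x : x \in ideal -> a * x * b \in ideal.
Proof.
move/spanP=> xI; apply/spanP; elim: xI => [u [c [g [d [Gg ->]]]]||c u v _ hu _ hv].
- by apply: span_gen; exists (a * c), g, (d * b); rewrite !mulrA.
- by rewrite mulr0 mul0r; exact: span_zero.
- by rewrite mulrDr mulrDl -scalerAr -scalerAl; exact: span_lin.
Qed.

Definition quotalg (_ : 1 \notin ideal) : Type :=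
  quotmod (fun x => exists a g b, G g /\ x = a * g * b).

Variable G1 : 1 \notin ideal.

HB.instance Definition _ := GRing.Lmodule.on (quotalg G1).

Definition api : B -> quotalg G1 := @qpi _ _ _.

HB.instance Definition _ := GRing.Linear.on api.

Lemma apiP u v : reflect (api u = api v) (u - v \in ideal).
Proof. exact: qpiP. Qed.

Lemma api_surj (x : quotalg G1) : api (repr x) = x.
Proof. exact: qpi_surj. Qed.

Definition qone : quotalg G1 := api 1.
Definition qmul (x y : quotalg G1) : quotalg G1 := api (repr x * repr y).

Lemma apiM u v : api (u * v) = qmul (api u) (api v).
Proof.
apply/apiP; have -> : u * v - repr (api u) * repr (api v) =
  1 * (u - repr (api u)) * v + repr (api u) * (v - repr (api v)) * 1.
  by rewrite mul1r mulr1 mulrBl mulrBr addrA subrK.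
by rewrite rpredD // idealM //; apply/apiP; rewrite api_surj.
Qed.

Lemma qmulA : associative qmul.
Proof.
move=> x y z; rewrite -(api_surj x) -(api_surj y) -(api_surj z).
by rewrite -!apiM mulrA.
Qed.

Lemma qmul1x : left_id qone qmul.
Proof. by move=> x; rewrite -(api_surj x) -apiM mul1r. Qed.

Lemma qmulx1 : right_id qone qmul.
Proof. by move=> x; rewrite -(api_surj x) -apiM mulr1. Qed.

Lemma qmulDl : left_distributive qmul +%R.
Proof.
move=> x y z; rewrite -(api_surj x) -(api_surj y) -(api_surj z).
by rewrite -linearD -!apiM mulrDl linearD.
Qed.

Lemma qmulDr : right_distributive qmul +%R.
Proof.
move=> x y z; rewrite -(api_surj x) -(api_surj y) -(api_surj z).
by rewrite -linearD -!apiM mulrDr linearD.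
Qed.

Lemma qone_neq0 : qone != 0.
Proof.
apply: contra G1 => /eqP q10; rewrite -[1]subr0; apply/apiP.
by rewrite linear0.
Qed.

HB.instance Definition _ := GRing.Zmodule_isNzRing.Build (quotalg G1)
  qmulA qmul1x qmulx1 qmulDl qmulDr qone_neq0.

Lemma qscaleAl (c : k) (x y : quotalg G1) : c *: (x * y) = c *: x * y.
Proof.
rewrite -(api_surj x) -(api_surj y); move: (repr x) (repr y) => u v.
have e (s t : B) : api s * api t = api (s * t) by rewrite apiM.
by rewrite e -(linearZ_LR api c (u * v)) -(linearZ_LR api c u) e scalerAl.
Qed.

Lemma qscaleAr (c : k) (x y : quotalg G1) : c *: (x * y) = x * (c *: y).
Proof.
rewrite -(api_surj x) -(api_surj y); move: (repr x) (repr y) => u v.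
have e (s t : B) : api s * api t = api (s * t) by rewrite apiM.
by rewrite e -(linearZ_LR api c (u * v)) -(linearZ_LR api c v) e scalerAr.
Qed.

HB.instance Definition _ :=
  GRing.LSemiModule_isLSemiAlgebra.Build k (quotalg G1) qscaleAl.
HB.instance Definition _ :=
  GRing.LSemiAlgebra_isSemiAlgebra.Build k (quotalg G1) qscaleAr.

Lemma api_monoid_morphism : monoid_morphism api.
Proof. by split=> // u v; exact: apiM. Qed.

HB.instance Definition _ :=
  GRing.isMonoidMorphism.Build B (quotalg G1) api api_monoid_morphism.
End QuotientAlgebra.

Section FreeModule.
Variables (k : fieldType) (X : choiceType) (M : lmodType k) (F : X -> M).

Definition free_lift (g : {malg k[X]}) : M := \sum_(x <- msupp g) g@_x *: F x.

Lemma free_liftEw (d : {fset X}) g : (msupp g `<=` d)%fset ->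
  free_lift g = \sum_(x <- d) g@_x *: F x.
Proof.
move=> le_gd; rewrite /free_lift (big_fset_incl _ le_gd) // => x _ /mcoeff_outdom ->.
by rewrite scale0r.
Qed.

Lemma free_liftU x : free_lift << x >> = F x.
Proof. by rewrite (free_liftEw msuppU_le) big_seq_fset1 mcoeffUU scale1r. Qed.

Lemma free_lift_linear : linear free_lift.
Proof.
move=> c g h; pose d := (msupp g `|` msupp h `|` msupp (c *: g + h))%fset.
have gd : (msupp g `<=` d)%fset.
  by apply/fsubsetP => x; rewrite !inE => ->.
have hd : (msupp h `<=` d)%fset.
  by apply/fsubsetP => x; rewrite !inE => ->; rewrite orbT.
rewrite (free_liftEw gd) (free_liftEw hd) (@free_liftEw d) ?fsubsetUr //.
rewrite scaler_sumr -big_split /=; apply: eq_bigr => x _.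
by rewrite mcoeffD mcoeffZ scalerDl scalerA.
Qed.

HB.instance Definition _ :=
  GRing.isLinear.Build k {malg k[X]} M *:%R free_lift free_lift_linear.
End FreeModule.

Definition word (V : choiceType) : Type := seq V.

HB.instance Definition _ V := Choice.on (word V).

Lemma word_unit (V : choiceType) (s t : word V) :
  s ++ t = [::] -> s = [::] /\ t = [::].
Proof. by case: s. Qed.

HB.instance Definition _ (V : choiceType) :=
  Choice_isMonomialDef.Build (word V) (@catA V) (@cat0s V) (@cats0 V)
    (@word_unit V).

Definition falg (k : fieldType) (V : choiceType) : Type := {malg k[word V]}.

HB.instance Definition _ (k : fieldType) (V : choiceType) :=
  GRing.Lalgebra.on (falg k V).

Lemma falg_scaleAr (k : fieldType) (V : choiceType) (c : k) (x y : falg k V) : c *: (x * y) = x * (c *: y).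
Proof.
have eZ (a b : k) (s : word V) : a *: << b *g s >> = << a * b *g s >>.
  by apply/malgP => t; rewrite mcoeffZ !mcoeffU mulrnAr.
rewrite (monalgE x) (monalgE y) !mulr_suml !scaler_sumr.
apply: eq_bigr => s _; rewrite !mulr_sumr scaler_sumr.
apply: eq_bigr => t _; rewrite eZ.
rewrite [_ * << _ *g t >> in LHS]fgmulUU [_ * _ in RHS]fgmulUU eZ.
by rewrite mulrCA.
Qed.

HB.instance Definition _ (k : fieldType) (V : choiceType) :=
  GRing.LSemiAlgebra_isSemiAlgebra.Build k (falg k V) (@falg_scaleAr k V).

Section TensorAlgebra.
Variables (k : fieldType) (V : lmodType k).

Definition letter (v : V) : falg k V := << [:: v] : word V >>.

(* T(V) is the free associative algebra on the set V, modulo linearity of     *)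
(* the inclusion of V.                                                        *)
Definition tensor_rel (x : falg k V) : Prop :=
  exists c u v, x = letter (c *: u + v) - (c *: letter u + letter v).

(* The augmentation T(V) -> k, used here only to show that T(V) and the       *)
(* N-homogeneous algebras are nonzero.                                        *)
Definition falg_aug (x : falg k V) : k^o := x@_(mone : word V).

Lemma falg_aug_linear : linear falg_aug.
Proof. by move=> c u v; rewrite /falg_aug mcoeffD mcoeffZ. Qed.

HB.instance Definition _ :=
  GRing.isLinear.Build k (falg k V) k^o *:%R falg_aug falg_aug_linear.

Lemma falg_augM x y : falg_aug (x * y) = falg_aug x * falg_aug y :> k.
Proof. exact: (rmorphM (@mcoeff (word V) k mone)). Qed.

Lemma falg_aug_letter v : falg_aug (letter v) = 0.
Proof. by rewrite /falg_aug mcoeffU. Qed.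

Lemma falg_aug_rel x : tensor_rel x -> falg_aug x = 0.
Proof.
move=> [c [u [v ->]]]; rewrite linearB linearP /= !falg_aug_letter.
by rewrite scaler0 addr0 subr0.
Qed.

Lemma falg_aug_ideal x :
  (exists a g b, tensor_rel g /\ x = a * g * b) -> falg_aug x = 0.
Proof.
move=> [a [g [b [Gg ->]]]].
by rewrite !falg_augM (falg_aug_rel Gg) mulr0 mul0r.
Qed.

Lemma tensor_rel_proper : 1 \notin ideal tensor_rel.
Proof.
apply/negP => /(span_vanish falg_aug_ideal) /eqP.
by rewrite /= /falg_aug mcoeff1 eqxx oner_eq0.
Qed.

Definition talg : algType k := quotalg tensor_rel_proper.

Definition tin (v : V) : talg := api tensor_rel_proper (letter v).

Lemma tin_linear : linear tin.
Proof.
move=> c u v; rewrite /tin -[RHS]linearP; apply/apiP/spanP/span_gen.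
exists 1, (letter (c *: u + v) - (c *: letter u + letter v)), 1.
by split; [exists c, u, v | rewrite mul1r mulr1].
Qed.

HB.instance Definition _ := GRing.isLinear.Build k V talg *:%R tin tin_linear.

Definition tpow (n : nat) : {pred talg} :=
  lspan (fun x => exists s : n.-tuple V, x = \prod_(v <- s) tin v).

HB.instance Definition _ n := GRing.SubmodClosed.on (tpow n).

Definition taug : talg -> k^o := qlift falg_aug_ideal.

HB.instance Definition _ := GRing.Linear.on taug.

Lemma taugE x : taug (api _ x) = falg_aug x.
Proof. exact: qliftE. Qed.

Lemma taug1 : taug 1 = 1 :> k.
Proof.
by rewrite -(rmorph1 (api tensor_rel_proper)) taugE /falg_aug mcoeff1 eqxx.
Qed.

Lemma taugM x y : taug (x * y) = taug x * taug y :> k.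
Proof.
rewrite -(api_surj x) -(api_surj y) -rmorphM !taugE; exact: falg_augM.
Qed.

Lemma taug_tpow n x : x \in tpow n.+1 -> taug x = 0.
Proof.
apply: (@span_vanish _ _ _ _ taug) => _ [s ->] /=.
by rewrite (tuple_eta s) big_cons taugM taugE falg_aug_letter mul0r.
Qed.
End TensorAlgebra.

Arguments tpow {k} V n.

Section HomogeneousAlgebra.
Variables (k : fieldType) (V : lmodType k) (N : nat) (hN : (1 < N)%N).
Variable R : submodClosed (subsp (tpow V N)).

Definition hom_rel (x : talg V) : Prop :=
  exists r : subsp (tpow V N), r \in R /\ x = val r.

Lemma hom_rel_proper : 1 \notin ideal hom_rel.
Proof.
have aug0 x : (exists a g b, hom_rel g /\ x = a * g * b) -> taug x = 0.
  move=> [a [_ [b [[[r rV] [_ ->]] ->]]]] /=.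
  rewrite !taugM (_ : taug r = 0) ?mulr0 ?mul0r //.
  by apply: (@taug_tpow _ _ N.-1); rewrite prednK // (ltn_trans _ hN).
apply/negP => /(span_vanish aug0) /eqP.
by rewrite /= taug1 oner_eq0.
Qed.

Definition halg : algType k := quotalg hom_rel_proper.

Definition hpi : talg V -> halg := api hom_rel_proper.

HB.instance Definition _ := GRing.LRMorphism.on hpi.

(* The intersection is taken inside V^{\otimes p}; in particular it is        *)
(* V^{\otimes p} when p < N.                                                  *)
Definition koszW_pred (p : nat) : {pred talg V} := fun x =>
  `[< x \in tpow V p /\
      forall i j, (i + N + j)%N = p ->
        x \in lspan (fun y => exists a r b,
          [/\ a \in tpow V i, r \in R, b \in tpow V j & y = a * val r * b]) >].

Lemma koszW_closed p : submod_closed (koszW_pred p).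
Proof.
split=> [|c u v /asboolP[up uW] /asboolP[vp vW]]; apply/asboolP; split.
- exact: rpred0.
- by move=> i j _; exact: rpred0.
- by rewrite rpredD ?rpredZ.
- by move=> i j e; rewrite rpredD ?rpredZ ?uW ?vW.
Qed.

HB.instance Definition _ p :=
  GRing.isSubmodClosed.Build k (talg V) (koszW_pred p) (koszW_closed p).

Definition koszW (p : nat) : lmodType k := subsp (koszW_pred p).

Definition nu (p : nat) : nat := (N * p./2 + odd p)%N.

End HomogeneousAlgebra.

HB.mixin Record isBimodule (k : fieldType) (A : algType k) M
    of GRing.Lmodule k M := {
  lact : A -> M -> M;
  ract : M -> A -> M;
  lact_linearl : forall m, linear (lact^~ m);
  lact_linearr : forall a, linear (lact a);
  ract_linearl : forall a, linear (ract^~ a);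
  ract_linearr : forall m, linear (ract m);
  lact1 : forall m, lact 1 m = m;
  ract1 : forall m, ract m 1 = m;
  lactM : forall a b m, lact (a * b) m = lact a (lact b m);
  ractM : forall m a b, ract m (a * b) = ract (ract m a) b;
  lract : forall a m b, ract (lact a m) b = lact a (ract m b)
}.

#[short(type="bimodType")]
HB.structure Definition Bimodule (k : fieldType) (A : algType k) :=
  { M of isBimodule k A M & GRing.Lmodule k M }.

Section RegularBimodule.
Variables (k : fieldType) (A : algType k).

Definition regular : Type := A.

HB.instance Definition _ := GRing.Algebra.on regular.

Lemma mul_linearl (m : A) : linear (fun a : A => a * m).
Proof. by move=> c a b; rewrite mulrDl scalerAl. Qed.

Lemma mul_linearr (a : A) : linear (fun m : A => a * m).
Proof. by move=> c m n; rewrite mulrDr scalerAr. Qed.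

HB.instance Definition _ := @isBimodule.Build k A regular
  (fun a m : A => a * m) (fun m a : A => m * a)
  mul_linearl mul_linearr mul_linearl mul_linearr
  (@mul1r A) (@mulr1 A) (fun a b m => esym (mulrA a b m))
  (@mulrA A) (fun a m b => esym (mulrA a m b)).
End RegularBimodule.

Section TensorOverA.
Variables (k : fieldType) (A : algType k) (P Q : bimodType A).

Definition pair_elt (p : P) (q : Q) : {malg k[(P * Q)%type]} := << (p, q) >>.

Inductive tensA_rel : {malg k[(P * Q)%type]} -> Prop :=
| tensA_linl c p p' q : tensA_rel
    (pair_elt (c *: p + p') q - (c *: pair_elt p q + pair_elt p' q))
| tensA_linr c p q q' : tensA_rel
    (pair_elt p (c *: q + q') - (c *: pair_elt p q + pair_elt p q'))
| tensA_bal p a q : tensA_rel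
    (pair_elt (ract p a) q - pair_elt p (lact a q)).

Definition tensA : lmodType k := quotmod tensA_rel.

Definition tens (p : P) (q : Q) : tensA := qpi tensA_rel (pair_elt p q).
End TensorOverA.

Section UnitIsomorphisms.
Variables (k : fieldType) (A : algType k) (M : bimodType A).

Let lfun := free_lift (fun am : regular A * M => lact (am.1 : A) am.2).
Let rfun := free_lift (fun ma : M * regular A => ract ma.1 (ma.2 : A)).

Lemma lunit_rel x : @tensA_rel _ _ (regular A) M x -> lfun x = 0.
Proof.
case=> [c a b m|c a m n|a b m]; rewrite /lfun linearB ?linearP /=.
all: rewrite /pair_elt !free_liftU /=.
- by rewrite lact_linearl scalerN -opprD subrr.
- by rewrite lact_linearr scalerN -opprD subrr.
- by rewrite -lactM subrr.
Qed.

Lemma runit_rel x : @tensA_rel _ _ M (regular A) x -> rfun x = 0.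
Proof.
case=> [c a b m|c a m n|a b m]; rewrite /rfun linearB ?linearP /=.
all: rewrite /pair_elt !free_liftU /=.
- by rewrite ract_linearl scalerN -opprD subrr.
- by rewrite ract_linearr scalerN -opprD subrr.
- by rewrite -ractM subrr.
Qed.

(* The isomorphisms of A \otimes_A M and M \otimes_A A with M. *)
Definition lunit : tensA (regular A) M -> M := qlift lunit_rel.
Definition runit : tensA M (regular A) -> M := qlift runit_rel.

HB.instance Definition _ := GRing.Linear.on lunit.
HB.instance Definition _ := GRing.Linear.on runit.

Lemma lunitE (a : A) m : lunit (tens (a : regular A) m) = lact a m.
Proof. by rewrite /lunit /tens qliftE; exact: free_liftU. Qed.

Lemma runitE m (a : A) : runit (tens m (a : regular A)) = ract m a.
Proof. by rewrite /runit /tens qliftE; exact: free_liftU. Qed.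
End UnitIsomorphisms.

(* Given m : X -> T and F : X -> M, the value at w \in T of the linear map    *)
(* with m x |-> F x: w is written as a sum \sum_i m x_i, and its value is     *)
(* \sum_i F x_i. In all uses below the sum \sum_i m x_i determines            *)
(* \sum_i F x_i, because k is a field; elements of W_p are viewed in this way *)
(* in V^{\otimes q} \otimes W_r \otimes V^{\otimes s}.                        *)
Definition linext (X : Type) (T M : zmodType) (m : X -> T) (F : X -> M)
    (w : T) : M :=
  if pselect (exists s : seq X, w = \sum_(x <- s) m x) is left ex_s
  then \sum_(x <- projT1 (cid ex_s)) F x else 0.

Lemma linextE (X : Type) (T M : zmodType) (m : X -> T) (F : X -> M)
    (h : {additive T -> M}) (s : seq X) :
  (forall x, h (m x) = F x) ->
  linext m F (\sum_(x <- s) m x) = \sum_(x <- s) F x.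
Proof.
move=> hE; rewrite /linext; case: pselect => [ex_s|[]]; last by exists s.
have /(congr1 h) := projT2 (cid ex_s); rewrite !raddf_sum => e.
by rewrite -(eq_bigr _ (fun x _ => hE x)) -e; apply: eq_bigr.
Qed.

Section KoszulCalculus.
Variables (k : fieldType) (V : lmodType k) (N : nat) (hN : (1 < N)%N).
Variable R : submodClosed (subsp (tpow V N)).

Local Notation A := (halg hN R).
Local Notation W := (koszW R).
Local Notation VV n := (subsp (tpow V n)).
Local Notation nu := (nu N).

Definition cochain (M : bimodType A) (p : nat) : Type :=
  {linear W (nu p) -> M}.

Definition sandwich (M : bimodType A) (r : nat) (f : W r -> M) (i : nat)
    (a : VV i) (y : W r) (j : nat) (b : VV j) : M :=
  ract (lact (hpi hN R (val a)) (f y)) (hpi hN R (val b)).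

(* x_1...x_i f(x_{i+1}...x_{i+r}) x_{i+r+1}...x_{i+r+j}                       *)
Definition insert (M : bimodType A) (r : nat) (f : W r -> M) (i j : nat)
    (w : talg V) : M :=
  linext (fun x : VV i * W r * VV j =>
            let: (a, y, b) := x in val a * val y * val b)
         (fun x => let: (a, y, b) := x in sandwich f a y b) w.

Definition kdiff (M : bimodType A) (p : nat) (f : cochain M p)
    (w : W (nu p.+1)) : M :=
  if odd p then \sum_(i < N) insert f i (N - 1 - i) (val w)
  else insert f 0 1 (val w) - insert f 1 0 (val w).

(* f(x_1...x_r) \otimes_A g(x_{r+1}...x_{r+s})                                *)
Definition juxtapose (P Q : bimodType A) (r s : nat) (f : W r -> P)
    (g : W s -> Q) (w : talg V) : tensA P Q :=
  linext (fun x : W r * W s => val x.1 * val x.2)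
         (fun x => tens (f x.1) (g x.2)) w.

(* x_1...x_i f(x_{i+1}...x_{i+r}) x_{i+r+1}...x_{i+r+l} \otimes_A             *)
(*   g(x_{i+r+l+1}...x_{i+r+l+s}) x_{i+r+l+s+1}...x_{i+r+l+s+j}               *)
Definition insert2 (P Q : bimodType A) (r s : nat) (f : W r -> P)
    (g : W s -> Q) (i l j : nat) (w : talg V) : tensA P Q :=
  linext (fun x : VV i * W r * VV l * W s * VV j =>
            let: (a, y, b, z, c) := x in
            val a * val y * val b * val z * val c)
         (fun x => let: (a, y, b, z, c) := x in
            tens (sandwich f a y b) (ract (g z) (hpi hN R (val c)))) w.

Definition kcup (P Q : bimodType A) (p q : nat) (f : cochain P p)
    (g : cochain Q q) (w : W (nu (p + q))) : tensA P Q :=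
  if odd p && odd q then
    - \sum_(i < N - 1) \sum_(j < N - 1 | (i + j <= N - 2)%N)
        insert2 f g i (N - 2 - i - j) j (val w)
  else juxtapose f g (val w).

Definition kbracket (M : bimodType A) (p q : nat) (f : cochain (regular A) p)
    (g : cochain M q) (w : W (nu (p + q))) : M :=
  lunit (kcup f g w) - (-1) ^+ (p * q) *:
  runit (kcup g f (ecast n (W (nu n)) (addnC p q) w)).

(* Here W (nu 1) = W_1 = V, seen in T(V).                                     *)
Definition fund_cocycle_fun (v : W (nu 1)) : regular A := hpi hN R (val v).

Lemma fund_cocycle_linear : linear fund_cocycle_fun.
Proof.
move=> c u v; rewrite /fund_cocycle_fun.
have -> : val (c *: u + v) = c *: val u + val v by [].
exact: (linearP (hpi hN R)).
Qed.

HB.instance Definition _ := GRing.isLinear.Build k (W (nu 1)) (regular A) *:%R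
  fund_cocycle_fun fund_cocycle_linear.

Definition fund_cocycle : cochain (regular A) 1 := fund_cocycle_fun.
End KoszulCalculus.

(* Main.v *)
From HB Require Import structures.
Require Import Defs.
From mathcomp Require Import all_boot all_order all_algebra.
From mathcomp Require Import boolp classical_sets finmap monalg zify.

(** Write H i j for the part x_1...x_i f(...) x_(n-j+1)...x_n of the formulas,
    n being the length of the argument. Since e_A is the inclusion of V in A,
    a cup product of e_A with f is a sum of terms H i j as soon as the unit
    isomorphism of A is applied: the factor e_A(x) merely rejoins the letters
    around it.

    If p is even, the two cup products are H 1 0 and H 0 1, whose difference
    is -b_K(f). If p is odd, the bracket is the sum of the two cup products.
    The pairs (i, j) with i + j <= N-2 give H (N-1-j) j in the first and
    H i (N-1-i) in the second. So T_i = H i (N-1-i) occurs i times in the first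
    (once for each first index below i) and N-1-i times in the second, hence
    N-1 times altogether whatever i is; with the sign of the odd cup product
    this gives (1-N) b_K(f).

    What takes work is that these formulas are evaluated on a decomposition of
    w into products, chosen separately for each formula; the argument above
    silently compares different choices. [insert_lift] removes the choice: f
    extends to a linear map on all of T(V) ([linear_extension], by Zorn's
    lemma), and because T(V) is universal for multilinear functions of words, a
    bilinear function of the first i letters and of the remaining ones defines
    a linear map on T(V) ([bilinear_split]); applying this twice yields one
    linear map on T(V) whose value at a y b is a f(y) b. [linext_transfer] then
    compares two formulas whose terms are read off from the same linear map,
    provided that each kind of product decomposes into the other kind.
    [lunit_insert2], [runit_insert2], [lunit_juxtapose] and [runit_juxtapose]
    are the resulting identifications with H i j, and [sum_simplex_pair] is the
    count. *)

Set Implicit Arguments.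
Unset Strict Implicit.
Unset Printing Implicit Defensive.

Import GRing.Theory.
Local Open Scope ring_scope.

(** * Extension of linear maps from a subspace *)

Section Extension.
Variables (k : fieldType) (U : lmodType k).

Lemma in_lspan_mono (G H : U -> Prop) u :
  (forall x, G x -> H x) -> in_lspan G u -> in_lspan H u.
Proof.
move=> GH; elim=> [x /GH|| c x y _ hx _ hy]; first exact: span_gen.
  exact: span_zero.
exact: span_lin.
Qed.

(** A linear combination involves finitely many elements, so in a chain a
    single member contains them all; only u = 0 can come from an empty chain. *)
Lemma in_lspan_bigcup (F : set (set U)) u : total_on F subset ->
  in_lspan (\bigcup_(X in F) X)%classic u ->
  u = 0 \/ exists2 X, F X & in_lspan X u.
Proof.
move=> totF; elim=> [x [X FX Xx]|| c x y _ hx _ hy].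
- by right; exists X => //; exact: span_gen.
- by left.
case: hx hy => [->|[X FX Xx]] [->|[Y FY Yy]].
- by left; rewrite scaler0 addr0.
- by right; exists Y; rewrite // scaler0 add0r.
- by right; exists X => //; apply: span_lin => //; exact: span_zero.
- right; case: (totF _ _ FX FY) => [XY|YX].
    by exists Y => //; apply: span_lin => //; exact: in_lspan_mono XY Xx.
  by exists X => //; apply: span_lin => //; exact: in_lspan_mono YX Yy.
Qed.

Lemma in_lspan_adjoin (C : set U) x u :
  in_lspan (C `|` [set x])%classic u ->
  exists c, in_lspan C (u - c *: x).
Proof.
elim=> [y [Cy|->]|| c y z _ [a ha] _ [b hb]].
- by exists 0; rewrite scale0r subr0; exact: span_gen.
- by exists 1; rewrite scale1r subrr; exact: span_zero.
- by exists 0; rewrite scale0r subr0; exact: span_zero.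
exists (c * a + b); rewrite scalerDl -scalerA opprD addrACA -scalerBr.
exact: span_lin.
Qed.

(** The complement is spanned by a maximal set C whose span meets S trivially.
    If no u - s with s in S were in the span of C, adjoining u to C would keep
    that property. *)
Lemma complement_exists (S : submodClosed U) :
  exists C : U -> Prop,
    (forall u, u \in lspan C -> u \in S -> u = 0) /\
    (forall u, exists s : subsp S, u - val s \in lspan C).
Proof.
pose P (X : set U) := forall u, in_lspan X u -> u \in S -> u = 0.
have chainP (F : set (set U)) : (F `<=` P)%classic -> total_on F subset ->
    P (\bigcup_(X in F) X)%classic.
  move=> FP totF u /(in_lspan_bigcup totF) [->//|[X FX Xu]].
  exact: FP Xu.
have [C [PC maxC]] := Zorn_bigcup chainP.
exists C; split=> [u /spanP|u]; first exact: PC.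
have [Cu|nCu] := pselect (C u).
  by exists 0; apply/spanP; rewrite subr0; exact: span_gen.
have: ~ P (C `|` [set u])%classic.
  by apply: maxC; split=> [|/(_ u (or_intror erefl))]; [exact: subsetUl|].
move=> /existsNP[w] /not_implyP[/in_lspan_adjoin [c Cw]] /not_implyP[wS w0].
have [c0|c0] := eqVneq c 0.
  by case: w0; apply: PC wS; move: Cw; rewrite c0 scale0r subr0.
(* w - c u is in the span of C, so u is w / c modulo that span. *)
exists (Subsp (rpredZ c^-1 wS)) => /=.
have -> : u - c^-1 *: w = - c^-1 *: (w - c *: u).
  by rewrite scalerBr scaleNr scaleNr opprK scalerA mulVf // scale1r addrC.
by apply: rpredZ; apply/spanP.
Qed.

(** Compose f with the projection onto S along a complement; the component in S
    is determined by its defining property, which makes it linear. *)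
Lemma linear_extension (S : submodClosed U) (M : lmodType k)
    (f : {linear subsp S -> M}) :
  exists g : {linear U -> M}, forall y : subsp S, g (val y) = f y.
Proof.
have [C [C0 /choice [s sP]]] := complement_exists S.
have uniq_s u (y : subsp S) : u - val y \in lspan C -> s u = y.
  move=> uy; apply/eqP; rewrite -subr_eq0; apply/eqP/val_inj/C0; last exact: valP.
  have -> : val (s u - y) = (u - val y) - (u - val (s u)).
    by rewrite opprB [_ - _ + _]addrC addrA subrK raddfB.
  exact: rpredB.
have lin : linear (f \o s).
  move=> c u v /=; rewrite -linearP; congr (f _); apply: uniq_s.
  have -> : val (c *: s u + s v) = c *: val (s u) + val (s v) by [].
  by rewrite opprD addrACA -scalerBr rpredD ?rpredZ.
pose gL := GRing.isLinear.Build _ _ _ _ _ lin.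
pose g : {linear U -> M} := HB.pack (f \o s) gL.
exists g => y /=; congr (f _); apply: uniq_s.
by rewrite subrr rpred0.
Qed.
End Extension.

(** * Multilinear functions of words *)

Section MultilinearSplit.
Variables (k : fieldType) (V : lmodType k) (T : algType k).
Variable iota : {linear V -> T}.

Definition vprod (s : seq V) : T := \prod_(v <- s) iota v.

Lemma vprod_cat s t : vprod (s ++ t) = vprod s * vprod t.
Proof. exact: big_cat. Qed.

Lemma vprod_letter s t c u v : vprod (s ++ (c *: u + v) :: t) =
  c *: vprod (s ++ u :: t) + vprod (s ++ v :: t).
Proof.
rewrite !vprod_cat /vprod !big_cons linearP mulrDl mulrDr.
by rewrite -scalerAl -scalerAr.
Qed.

Definition multilinear (M : lmodType k) (phi : seq V -> M) : Prop :=
  forall s t c u v, phi (s ++ (c *: u + v) :: t) =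
    c *: phi (s ++ u :: t) + phi (s ++ v :: t).

(** These two properties characterize T as the tensor algebra of V. *)
Hypothesis vprod_span : forall x : T,
  exists ts : seq (k * seq V), x = \sum_(t <- ts) t.1 *: vprod t.2.
Hypothesis vprod_lift : forall (M : lmodType k) (phi : seq V -> M),
  multilinear phi -> exists h : {linear T -> M}, forall s, h (vprod s) = phi s.

(** Cutting a word after its i-th letter makes B a function of words, which is
    multilinear because a letter lies on exactly one side of the cut. *)
Lemma bilinear_split_of_lift (M : lmodType k) (B : T -> T -> M) (i : nat) :
  (forall b, linear (B^~ b)) -> (forall a, linear (B a)) ->
  exists h : {linear T -> M}, forall a b,
    in_lspan (fun x => exists s : i.-tuple V, x = vprod s) a ->
    h (a * b) = B a b.
Proof.
move=> Bl Br; pose phi s := B (vprod (take i s)) (vprod (drop i s)).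
have [s t c u v|h hE] := @vprod_lift M phi.
  rewrite /phi !take_cat !drop_cat; case: ltnP => si.
    by rewrite vprod_letter Br.
  case: (i - size s)%N => [|n] /=; last by rewrite vprod_letter Bl.
  by rewrite (vprod_letter [::]) Br.
exists h => a b.
elim=> [_ [s ->]|| c x y _ hx _ hy].
- pose Bs : {linear T -> M} :=
    HB.pack (B (vprod s)) (GRing.isLinear.Build _ _ _ _ _ (Br _)).
  have [ts ->] := vprod_span b; rewrite mulr_sumr -[RHS]/(Bs _) !linear_sum.
  apply: eq_bigr => t _; rewrite -scalerAr !linearZ_LR; congr (_ *: _).
  rewrite -vprod_cat hE /phi.
  by rewrite take_size_cat ?drop_size_cat ?size_tuple.
- pose Bb : {linear T -> M} :=
    HB.pack (B^~ b) (GRing.isLinear.Build _ _ _ _ _ (Bl b)).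
  by rewrite mul0r linear0 -[RHS]/(Bb 0) linear0.
- by rewrite mulrDl -scalerAl linearP hx hy Bl.
Qed.

Lemma tuple_span_ind (P : T -> Prop) m n :
  P 0 -> (forall x y, P x -> P y -> P (x + y)) ->
  (forall s t : seq V, size s = m -> size t = n ->
     forall c, P (c *: vprod s * vprod t)) ->
  forall u, in_lspan (fun x => exists s : (m + n).-tuple V, x = vprod s) u ->
  P u.
Proof.
(* The scalar is generalized so that the induction absorbs c *: u + v. *)
move=> P0 PD PM u uS; rewrite -[u]scale1r; elim: uS 1 => [_ [s ->] c|c|].
- rewrite -(cat_take_drop m s) vprod_cat scalerAl; apply: PM.
    by rewrite size_takel // size_tuple leq_addr.
  by rewrite size_drop size_tuple addKn.
- by rewrite scaler0.
- by move=> c x y _ hx _ hy d; rewrite scalerDr scalerA; apply: PD.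
Qed.

Lemma tuple_spanM m n a b :
  in_lspan (fun x => exists s : m.-tuple V, x = vprod s) a ->
  in_lspan (fun x => exists s : n.-tuple V, x = vprod s) b ->
  in_lspan (fun x => exists s : (m + n).-tuple V, x = vprod s) (a * b).
Proof.
move=> aS bS; elim: aS => [_ [s ->]|| c x y _ hx _ hy].
- elim: bS => [_ [t ->]|| c x y _ hx _ hy].
  + by apply: span_gen; exists (cat_tuple s t); rewrite /= vprod_cat.
  + by rewrite mulr0; exact: span_zero.
  + by rewrite mulrDr -scalerAr; exact: span_lin.
- by rewrite mul0r; exact: span_zero.
- by rewrite mulrDl -scalerAl; exact: span_lin.
Qed.
End MultilinearSplit.

(** * The universal property of T(V) *)

Section TensorAlgebraUniversal.
Variables (k : fieldType) (V : lmodType k).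

Local Notation tprod := (vprod (@tin k V)).

Definition fword (s : seq V) : falg k V := << (s : word V) >>.

Lemma fword_cat s t : fword (s ++ t) = fword s * fword t.
Proof. by rewrite /fword [RHS]fgmulUU mulr1. Qed.

Lemma api_fword s : api (tensor_rel_proper V) (fword s) = tprod s.
Proof.
elim: s => [|v s IH]; first by rewrite /vprod big_nil; exact: (rmorph1 (api _)).
by rewrite -cat1s vprod_cat fword_cat rmorphM /= IH /vprod big_seq1.
Qed.

Lemma falg_sum (x : falg k V) :
  exists ts : seq (k * seq V), x = \sum_(t <- ts) t.1 *: fword t.2.
Proof.
exists [seq (x@_s, s) | s <- msupp x]; rewrite big_map {1}(monalgE x).
apply: eq_bigr => s _; apply/malgP => t.
by rewrite mcoeffZ !mcoeffU mulrnAr mulr1.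
Qed.

Lemma talg_sum (x : talg V) :
  exists ts : seq (k * seq V), x = \sum_(t <- ts) t.1 *: tprod t.2.
Proof.
have [ts xE] := falg_sum (repr x); exists ts.
rewrite -[LHS]api_surj xE (linear_sum (api (tensor_rel_proper V))).
apply: eq_bigr => t _.
by rewrite /= -api_fword -(linearZ_LR (api (tensor_rel_proper V))).
Qed.

(** On the free algebra any function of words extends linearly; multilinearity
    is exactly the vanishing of this extension on the ideal defining T(V). *)
Lemma word_lift (M : lmodType k) (phi : seq V -> M) :
  multilinear phi ->
  exists h : {linear talg V -> M}, forall s, h (tprod s) = phi s.
Proof.
move=> phiL; have [F FE] :
    exists F : {linear falg k V -> M}, forall s, F (fword s) = phi s.
  exists (@free_lift k (word V) M phi : {linear _ -> _}) => s.
  exact: free_liftU.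
have F0 x : (exists a g b, tensor_rel g /\ x = a * g * b) -> F x = 0.
  move=> [a [g [b [[c [u [v gE]]] ->]]]].
  have Fg s t : F (fword s * g * fword t) = 0.
    have [H HE] : exists H : V -> falg k V,
      forall w, H w = fword s * letter w * fword t.
      by exists (fun w => fword s * letter w * fword t).
    have HF w : F (H w) = phi (s ++ w :: t).
      by rewrite HE -[letter w]/(fword [:: w]) -!fword_cat -catA FE.
    have -> : fword s * g * fword t = H (c *: u + v) - (c *: H u + H v).
      by rewrite gE !HE mulrBr mulrBl mulrDr mulrDl -scalerAr -scalerAl.
    by rewrite (linearB F) (linearP F) !HF phiL subrr.
  have [ss ->] := falg_sum a; have [ts ->] := falg_sum b.
  rewrite -mulrA mulr_suml linear_sum big1 // => s _.
  rewrite -scalerAl linearZ_LR mulrA mulr_sumr linear_sum big1 ?scaler0 // => t _.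
  by rewrite -scalerAr linearZ_LR Fg scaler0.
exists (qlift F0 : {linear _ -> _}) => s.
by rewrite -api_fword [LHS]qliftE FE.
Qed.

Lemma bilinear_split (M : lmodType k) (B : talg V -> talg V -> M) (i : nat) :
  (forall b, linear (B^~ b)) -> (forall a, linear (B a)) ->
  exists h : {linear talg V -> M},
    forall a b, a \in tpow V i -> h (a * b) = B a b.
Proof.
move=> Bl Br; have [h hE] := bilinear_split_of_lift talg_sum word_lift i Bl Br.
by exists h => a b /spanP; exact: hE.
Qed.

Lemma tprod_tpow s n : size s = n -> tprod s \in tpow V n.
Proof. by move=> <-; apply/spanP/span_gen; exists (in_tuple s). Qed.

Lemma tpowM m n a b :
  a \in tpow V m -> b \in tpow V n -> a * b \in tpow V (m + n).
Proof.
by move=> /spanP aS /spanP bS; apply/spanP; exact: tuple_spanM aS bS.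
Qed.

(** V^{m+n} is spanned by the products of V^m and V^n, in the form of an
    induction principle for properties stable under sums. *)
Lemma tpow_split_ind (P : talg V -> Prop) m n :
  P 0 -> (forall x y, P x -> P y -> P (x + y)) ->
  (forall a b, a \in tpow V m -> b \in tpow V n -> P (a * b)) ->
  forall u, u \in tpow V (m + n) -> P u.
Proof.
move=> P0 PD PM u /spanP.
apply: (tuple_span_ind (iota := @tin k V)) => // s t sm tn c.
by apply: PM; rewrite ?rpredZ ?tprod_tpow.
Qed.
End TensorAlgebraUniversal.

(** * Values that do not depend on a decomposition *)

Section LinearExtensionValues.

Definition decomposable (X : Type) (T : zmodType) (m : X -> T) (w : T) : Prop :=
  exists s : seq X, w = \sum_(x <- s) m x.

Section Decomposable.
Variables (X : Type) (T : zmodType) (m : X -> T).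

Lemma decomposable0 : decomposable m 0.
Proof. by exists [::]; rewrite big_nil. Qed.

Lemma decomposableD u v :
  decomposable m u -> decomposable m v -> decomposable m (u + v).
Proof. by move=> [s ->] [t ->]; exists (s ++ t); rewrite big_cat. Qed.

Lemma decomposable_gen x : decomposable m (m x).
Proof. by exists [:: x]; rewrite big_seq1. Qed.
End Decomposable.

Lemma decomposable_trans (X1 X2 : Type) (T : zmodType)
    (m1 : X1 -> T) (m2 : X2 -> T) w :
  (forall x, decomposable m2 (m1 x)) -> decomposable m1 w -> decomposable m2 w.
Proof.
move=> m12 [s ->]; elim/big_ind: _ => // [|u v]; first exact: decomposable0.
exact: decomposableD.
Qed.

(** Both sides are the value of h at w when w decomposes. The two kinds of
    generators decompose the same elements, so that both sides are 0 at the
    other w. *)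
Lemma linext_transfer (X1 X2 : Type) (T M1 M : zmodType) (m1 : X1 -> T)
    (F1 : X1 -> M1) (m2 : X2 -> T) (F2 : X2 -> M)
    (L : {additive M1 -> M}) (h : {additive T -> M}) :
  (forall x, h (m1 x) = L (F1 x)) -> (forall x, h (m2 x) = F2 x) ->
  (forall x, decomposable m2 (m1 x)) -> (forall x, decomposable m1 (m2 x)) ->
  forall w, L (linext m1 F1 w) = linext m2 F2 w.
Proof.
move=> h1 h2 m12 m21 w; rewrite {1}/linext; case: pselect => [dec1|ndec1].
  have [s2 w2] := decomposable_trans m12 dec1.
  transitivity (h w); last by rewrite w2 (linextE _ h2) raddf_sum; apply: eq_bigr.
  by rewrite raddf_sum -(eq_bigr _ (fun x _ => h1 x)) -raddf_sum -(projT2 (cid dec1)).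
rewrite raddf0 /linext; case: pselect => // dec2.
by case: ndec1; exact: decomposable_trans m21 dec2.
Qed.
End LinearExtensionValues.

(** * Cup products with the fundamental cocycle *)

Section KoszulInsertions.
Variables (k : fieldType) (V : lmodType k) (N : nat) (hN : (1 < N)%N).
Variable R : submodClosed (subsp (tpow V N)).
Local Notation A := (halg hN R).
Local Notation W := (koszW R).
Local Notation VV n := (subsp (tpow V n)).
Local Notation nu := (nu N).
Local Notation e := (fund_cocycle hN R).
Local Notation hp := (hpi hN R).

Lemma koszW_tpow p (y : W p) : val y \in tpow V p.
Proof. by have /asboolP[] := valP y. Qed.

Lemma nu1 : nu 1 = 1%N.
Proof. by rewrite /Defs.nu muln0. Qed.

Lemma koszW1_tpow (y : W (nu 1)) : val y \in tpow V 1.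
Proof. by move: (val y) (koszW_tpow y) => v; rewrite nu1. Qed.

Lemma tpow1_koszW (v : talg V) :
  v \in tpow V 1 -> exists y : W (nu 1), val y = v.
Proof.
move=> vV; have vW : v \in koszW_pred R (nu 1).
  apply/asboolP; rewrite nu1; split=> // i j ij.
  by move: hN; rewrite ltnNge -ij addnAC leq_addl.
by exists (Subsp vW).
Qed.

Variable M : bimodType A.

(** The linear map whose value at a y b is a f(y) b: with f extended to T(V),
    split y b after r letters, then a (y b) after i letters. *)
Lemma insert_lift (r : nat) (f : {linear W r -> M}) (i : nat) :
  exists h : {linear talg V -> M},
    forall a (y : W r) b, a \in tpow V i ->
      h (a * val y * b) = ract (lact (hp a) (f y)) (hp b).
Proof.
have [f1 f1E] := linear_extension f.
have hpL : linear hp by exact: linearP.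
have [|| g gE] :=
  @bilinear_split k V M (fun y b => ract (f1 y) (hp b)) r.
- by move=> b c u v; rewrite (linearP f1) ract_linearl.
- by move=> y c u v; rewrite hpL; exact: ract_linearr.
have [|| h hE] := @bilinear_split k V M (fun a x => lact (hp a) (g x)) i.
- by move=> x c u v; rewrite hpL; exact: lact_linearl.
- by move=> a c u v; rewrite (linearP g) lact_linearr.
exists h => a y b aV.
by rewrite -mulrA hE // gE ?koszW_tpow // f1E lract.
Qed.

Variables (r : nat) (f : {linear W r -> M}).

(** Criterion for a formula to compute the insertion of f after i letters: its
    terms have the shape of such insertions, and its generators suffice to write
    every product a y b. *)
Lemma linext_insert (X : Type) (M1 : zmodType) (m : X -> talg V) (F : X -> M1)
    (L : {additive M1 -> M}) (i j : nat) :
  (forall x, exists (a : VV i) (y : W r) (b : VV j),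
     m x = val a * val y * val b /\ L (F x) = sandwich f a y b) ->
  (forall a (y : W r) b, a \in tpow V i -> b \in tpow V j ->
     decomposable m (a * val y * b)) ->
  forall w, L (linext m F w) = insert f i j w.
Proof.
move=> mF dec w; have [h hE] := insert_lift f i.
apply: (linext_transfer (h := h)) => [x|[[a y] b]|x|[[a y] b]].
- by have [a [y [b [-> ->]]]] := mF x; exact: hE (valP a).
- exact: hE (valP a).
- have [a [y [b [-> _]]]] := mF x.
  by exists [:: (a, y, b)]; rewrite big_seq1.
- exact: dec (valP a) (valP b).
Qed.

(** The letters before, at and after the place of e_A merge into one block. *)
Lemma lunit_insert2 i l j w :
  lunit (insert2 e f i l j w) = insert f (i + 1 + l) j w.
Proof.
apply: linext_insert => [[[[[a y] b] z] c]|ayb z c aybV cV].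
- have aybV : val a * val y * val b \in tpow V (i + 1 + l).
    exact: tpowM (tpowM (valP a) (koszW1_tpow y)) (valP b).
  exists (Subsp aybV), z, c; split=> //; apply: (etrans (lunitE _ _)).
  by rewrite /sandwich -lract /= !(rmorphM hp).
- set m2 := (X in decomposable X).
  pose P u := decomposable m2 (u * val z * c).
  have P0 : P 0 by rewrite /P !mul0r; exact: decomposable0.
  have PD u v : P u -> P v -> P (u + v).
    by rewrite /P !mulrDl; exact: decomposableD.
  apply: (tpow_split_ind P0 PD _ aybV) => ay b ayV bV.
  move: ay ayV; apply: tpow_split_ind => [|u v|a y aV /tpow1_koszW [y' <-]].
  + by rewrite mul0r.
  + by rewrite mulrDl; exact: PD.
  + exact: (decomposable_gen m2 (Subsp aV, y', Subsp bV, z, Subsp cV)).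
Qed.

Lemma runit_insert2 i l j w :
  runit (insert2 f e i l j w) = insert f i (l + 1 + j) w.
Proof.
apply: linext_insert => [[[[[a z] b] y] c]|a z byc aV bycV].
- have bycV : val b * val y * val c \in tpow V (l + 1 + j).
    exact: tpowM (tpowM (valP b) (koszW1_tpow y)) (valP c).
  exists a, z, (Subsp bycV); split; first by rewrite /= !mulrA.
  apply: (etrans (runitE _ _)).
  rewrite /sandwich -ractM; congr (ract _ _).
  by rewrite /= !(rmorphM hp); exact: mulrA.
- set m2 := (X in decomposable X).
  pose P u := decomposable m2 (a * val z * u).
  have P0 : P 0 by rewrite /P mulr0; exact: decomposable0.
  have PD u v : P u -> P v -> P (u + v).
    by rewrite /P mulrDr; exact: decomposableD.
  apply: (tpow_split_ind P0 PD _ bycV) => b_y c byV cV.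
  move: b_y byV; apply: tpow_split_ind => [|u v|b y bV /tpow1_koszW [y' <-]].
  + by rewrite mul0r.
  + by rewrite mulrDl; exact: PD.
  + rewrite /P !mulrA.
    exact: (decomposable_gen m2 (Subsp aV, z, Subsp bV, y', Subsp cV)).
Qed.

Lemma tpow0E (a : talg V) : a \in tpow V 0 -> exists c : k, a = c%:A.
Proof.
move/spanP; elim=> [_ [s ->]|| c x y _ [d ->] _ [d' ->]].
- by exists 1; rewrite tuple0 big_nil scale1r.
- by exists 0; rewrite scale0r.
- by exists (c * d + d'); rewrite scalerDl scalerA.
Qed.

Lemma one_tpow0 : (1 : talg V) \in tpow V 0.
Proof. by apply/spanP/span_gen; exists [tuple]; rewrite big_nil. Qed.

(** The block of length 0 in an insertion contributes a scalar, which moves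
    into the letter x_1. *)
Lemma lunit_juxtapose w : lunit (juxtapose e f w) = insert f 1 0 w.
Proof.
apply: linext_insert => [[y z]|a z b aV /tpow0E [c ->]].
- exists (Subsp (koszW1_tpow y)), z, (Subsp one_tpow0); split.
    by rewrite /= mulr1.
  apply: (etrans (lunitE _ _)); rewrite /sandwich /=.
  by rewrite (rmorph1 hp) ract1.
- have /tpow1_koszW [y yE] : c *: a \in tpow V 1 by rewrite rpredZ.
  rewrite mulr_algr scalerAl -yE.
  exact: (decomposable_gen _ (y, z)).
Qed.

Lemma runit_juxtapose w : runit (juxtapose f e w) = insert f 0 1 w.
Proof.
apply: linext_insert => [[z y]|a z b /tpow0E [c ->] bV].
- exists (Subsp one_tpow0), z, (Subsp (koszW1_tpow y)); split.
    by rewrite /= mul1r.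
  apply: (etrans (runitE _ _)); rewrite /sandwich /=.
  by rewrite (rmorph1 hp) lact1.
- have /tpow1_koszW [y yE] : c *: b \in tpow V 1 by rewrite rpredZ.
  rewrite mulr_algl -scalerAl scalerAr -yE.
  exact: (decomposable_gen _ (z, y)).
Qed.

Lemma val_ecast p q (E : p = q) (w : W (nu p)) :
  val (ecast n (W (nu n)) E w) = val w.
Proof. by case: q / E. Qed.
End KoszulInsertions.

(** * Counting the terms of the odd cup products *)

Lemma sum_simplex (M : zmodType) n (T : nat -> M) :
  \sum_(i < n) \sum_(j < n | (i + j < n)%N) T i = \sum_(i < n) T i *+ (n - i).
Proof.
apply: eq_bigr => i _; rewrite -[(n - i)%N in RHS]card_ord -sumr_const.
rewrite (big_ord_widen n (fun _ => T i)) ?leq_subr //.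
by apply: eq_bigl => j; rewrite ltn_subRL.
Qed.

(** The term T i occurs i times in the first sum and n - i times in the second.
    The index i = n is missing from the second sum and i = 0 from the first, in
    accordance with these multiplicities. *)
Lemma sum_simplex_pair (M : zmodType) n (T : nat -> M) :
  \sum_(i < n) \sum_(j < n | (i + j < n)%N) T (n - j)%N +
  \sum_(i < n) \sum_(j < n | (i + j < n)%N) T i = (\sum_(i < n.+1) T i) *+ n.
Proof.
rewrite (exchange_big_dep xpredT) //=.
under eq_bigr => j _ do under eq_bigl => i do rewrite addnC.
rewrite (sum_simplex n (fun j => T (n - j)%N)) sum_simplex.
rewrite (reindex_inj rev_ord_inj) /=.
rewrite (eq_bigr (fun i : 'I_n => T i.+1 *+ i.+1)) => [|i _]; last first.
  by rewrite !subKn.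
rewrite -sumrMnl.
(* T 0 and T n are added with multiplicity 0, so that both sums range over
   i <= n. *)
rewrite -[X in X + _]add0r.
rewrite -[X in X + _ + _](mulr0n (T 0%N)) -(big_ord_recl n (fun i => T i *+ i)).
rewrite -[X in _ + X]addr0 -[X in _ + (_ + X)](mulr0n (T n)) -[X in _ *+ X](subnn n).
rewrite -(big_ord_recr n (fun i => T i *+ (n - i))) -big_split.
by apply: eq_bigr => i _; rewrite /= -mulrnDr subnKC // -ltnS.
Qed.

Theorem theorem4p3 (k : fieldType) (V : lmodType k) (N : nat) (hN : (1 < N)%N)
    (R : submodClosed (subsp (tpow V N))) (M : bimodType (halg hN R))
    (p : nat) (f : cochain M p) :
  (~~ odd p -> forall w : koszW R (nu N p.+1),
     kbracket (fund_cocycle hN R) f w = - kdiff f w) /\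
  (odd p -> forall w : koszW R (nu N p.+1),
     kbracket (fund_cocycle hN R) f w = (1 - N%:R : k) *: kdiff f w).
Proof.
split=> [/negbTE p_even|p_odd] w; rewrite /kbracket /kcup /kdiff val_ecast mul1n.
- rewrite p_even /= -signr_odd p_even expr0 scale1r.
  by rewrite lunit_juxtapose runit_juxtapose opprB.
rewrite p_odd /= -signr_odd p_odd expr1 scaleN1r opprK.
pose T i := insert f i (N - 1 - i) (val w).
have ltN m : (m < N - 1)%N = (m <= N - 2)%N by lia.
have e_f : lunit (\sum_(i < N - 1) \sum_(j < N - 1 | (i + j <= N - 2)%N)
      insert2 (fund_cocycle hN R) f i (N - 2 - i - j) j (val w)) =
    \sum_(i < N - 1) \sum_(j < N - 1 | (i + j < N - 1)%N) T (N - 1 - j)%N.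
  rewrite linear_sum; apply: eq_bigr => i _; rewrite linear_sum.
  apply: eq_big => [j|j ijN]; first by rewrite ltN.
  apply: etrans (lunit_insert2 _ _ _ _ _) _; rewrite /T.
  by congr (insert f _ _ _); lia.
have f_e : runit (\sum_(i < N - 1) \sum_(j < N - 1 | (i + j <= N - 2)%N)
      insert2 f (fund_cocycle hN R) i (N - 2 - i - j) j (val w)) =
    \sum_(i < N - 1) \sum_(j < N - 1 | (i + j < N - 1)%N) T i.
  rewrite linear_sum; apply: eq_bigr => i _; rewrite linear_sum.
  apply: eq_big => [j|j ijN]; first by rewrite ltN.
  apply: etrans (runit_insert2 _ _ _ _ _) _; rewrite /T.
  by congr (insert f _ _ _); lia.
rewrite !linearN /= e_f f_e -opprD sum_simplex_pair.
have -> : (N - 1).+1 = N by lia.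
have -> : 1 - N%:R = - (N - 1)%:R :> k by rewrite natrB ?opprB // ltnW.
by rewrite scaleNr scaler_nat.
Qed.
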